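(* Let $X_1,\dots,X_k$ be sorts of a graded probability space and assume that $E\in\mathcal{B}_{X_1\times\dots\times X_k}$ is partition-wise $\mu$-stable. Then $E$ satisfies definable perfect stable regularity.
   Context: Graded probability space: fix base sets $V_1,\dots,V_m$; a sort is any finite cartesian product of the $V_i$'s, in any order and possibly with repetitions. A graded probability space specifies for each sort $X$ a $\sigma$-algebra $\mathcal{B}_X\subseteq\mathcal{P}(X)$ and a countably additive probability measure $\mu_X$ on it (both often written without subscript) such that for all sorts $X,Y$: $\mathcal{B}_{X\times Y}\supseteq\mathcal{B}_X\times\mathcal{B}_Y$ and $\mu_{X\times Y}$ extends the product measure; permuting coordinates preserves measurability and measure; and (Fubini) for $A\in\mathcal{B}_{X\times Y}$, $A_y\in\mathcal{B}_X$ for $\mu_Y$-almost every $y$, $y\mapsto\mu_X(A_y)$ is $\mu_Y$-measurable and $\mu_{X\times Y}(A)=\int_Y\mu_X(A_y)\,d\mu_Y$. $\mu$-stability: for $R\in\mathcal{B}_{X\times Y}$ and $d\ge1$, let $\mathrm{Tree}^{R,d}\subseteq X^{2^d}\times Y^{2^d-1}$ be the set of tuples $(a_\sigma:\sigma\in2^d)^\frown(b_\sigma:\sigma\in2^{<d})$ with $(a_\sigma,b_{\sigma|_i})\in R\iff\sigma(i)=1$ for all $\sigma\in2^d$ (0-1 sequences of length $d$), $i<d$, where $\sigma|_i$ is the initial segment of length $i$. $R$ is $d$-$\mu$-stable if $\mu(\mathrm{Tree}^{R,d})=0$. $E\in\mathcal{B}_{X_1\times\dots\times X_k}$ is partition-wise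 $\mu$-stable if there is $d$ such that for every $1\le\ell\le k$, $E$ viewed as a binary relation on $X_\ell\times\prod_{i\ne\ell}X_i$ is $d$-$\mu$-stable. Algebras of fibers: let $E\in\mathcal{B}_W$ with $W=\prod_{t\in[K]}V_{i_t}$. For $I\subseteq[K]$ and $W_I=\prod_{t\in I}V_{i_t}$, let $\mathcal{F}^{0,E}_{W_I}$ be the collection of all fibers $E_{\bar b}\subseteq W_I$, $\bar b\in\prod_{t\in[K]\setminus I}V_{i_t}$, and their complements (all these are taken to be in $\mathcal{B}_{W_I}$). For a sort $S=\prod_{t\in[L]}V_{j_t}$, $\mathcal{F}^{E,N}_S$ is the collection of sets $\{(b_i:i\in[L])\in S:\bigwedge_{\ell\in[N]}(b_i:i\in J_\ell)\in S_\ell\}$ with $J_\ell\subseteq[L]$, $I_\ell\subseteq[K]$, $(j_t:t\in J_\ell)=(i_t:t\in I_\ell)$ and $S_\ell\in\mathcal{F}^{0,E}_{W_{I_\ell}}$. $\mathcal{B}^E_S$ is the $\sigma$-algebra generated by $\bigcup_N\mathcal{F}^{E,N}_S$. $E$ satisfies definable perfect stable regularity if for each $1\le t\le k$ there is a countable partition $\{A_{t,i}:i\in\omega\}$ of $X_t$ with $A_{t,i}\in\mathcal{B}^E_{X_t}$ such that for every $(i_1,\dots,i_k)\in\omega^k$, $\frac{\mu(E\cap(A_{1,i_1}\times\dots\times A_{k,i_k}))}{\mu(A_{1,i_1}\times\dots\times A_{k,i_k})}\in\{0,1\}$ whenever the denominator is nonzero (equivalently, each $A_{t,i}$ is perfect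 for $E$ viewed as a binary relation on $X_t\times\prod_{s\ne t}X_s$, i.e. for almost every $b\in\prod_{s\ne t}X_s$, $\mu(A_{t,i}\cap E_b)=0$ or $\mu(A_{t,i}\setminus E_b)=0$). *)

(* Defs.v *)
From HB Require Import structures.
From mathcomp Require Import all_boot all_order all_algebra.
From mathcomp Require Import all_classical all_reals all_analysis.
From mathcomp Require Import measurable_realfun.

Set Implicit Arguments.
Unset Strict Implicit.
Unset Printing Implicit Defensive.

Import Order.TTheory GRing.Theory Num.Theory.

Local Open Scope classical_set_scope.
Local Open Scope ring_scope.

(* The sequence (s_i : i in l). An index i >= size s is skipped. *)
Definition select (T : Type) (l : seq nat) (s : seq T) : seq T :=
  pmap (onth s) l.

Lemma map_select (T U : Type) (f : T -> U) (l : seq nat) (s : seq T) :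
  map f (select l s) = select l (map f s).
Proof.
elim: l => [//|i l IH]; rewrite /select /= onth_map.
by case: (onth s i) => [x|] /=; rewrite -/(select l s) IH.
Qed.

(* The sort V_{i_1} * ... * V_{i_n} is the word [:: i_1; ...; i_n]. The empty
   word is the one-point empty product, and the product of two sorts is their
   concatenation. *)
Definition gsort (m : nat) := seq 'I_m.

Section Points.
Context {m : nat} (V : 'I_m -> pointedType).

(* A point of the sort s is a sequence of elements of the base sets, each
   tagged with the index of its base set, whose tags spell s. *)
Record points (s : gsort m) := Points {
  pval : seq {i : 'I_m & V i};
  pvalP : map tag pval == s
}.

HB.instance Definition _ s := [isSub for @pval s].
HB.instance Definition _ s := [Choice of points s by <:].

Definition mkpoints (s : gsort m) (x : seq {i : 'I_m & V i})
  (xs : map tag x = s) : points s := Points (introT eqP xs).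

Lemma pbase_subproof (s : gsort m) :
  map tag [seq Tagged V (point : V i) | i <- s] = s.
Proof. by rewrite -map_comp map_id. Qed.

HB.instance Definition _ s :=
  isPointed.Build (points s) (mkpoints (pbase_subproof s)).

End Points.

Section PointOperations.
Context {m : nat} {V : 'I_m -> pointedType}.
Implicit Types s t : gsort m.

Lemma pcat_subproof s t (x : points V s) (y : points V t) :
  map tag (val x ++ val y) = s ++ t.
Proof. by rewrite map_cat (eqP (valP x)) (eqP (valP y)). Qed.

Definition pcat s t (x : points V s) (y : points V t) : points V (s ++ t) :=
  mkpoints (pcat_subproof x y).

Lemma pselect_subproof s (l : seq nat) (x : points V s) :
  map tag (select l (val x)) = select l s.
Proof. by rewrite map_select (eqP (valP x)). Qed.

Definition pselect s (l : seq nat) (x : points V s) : points V (select l s) :=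
  mkpoints (pselect_subproof l x).

(* The product of the sorts X i, for i ranging over the word r. *)
Definition sprod (I : Type) (r : seq I) (X : I -> gsort m) : gsort m :=
  flatten [seq X i | i <- r].

Lemma ptuple_subproof (I : Type) (r : seq I) (X : I -> gsort m)
    (x : forall i, points V (X i)) :
  map tag (flatten [seq val (x i) | i <- r]) = sprod r X.
Proof.
rewrite map_flatten -map_comp; congr flatten.
by apply: eq_map => i /=; rewrite (eqP (valP (x i))).
Qed.

(* The point (x_i : i in r) of this product. *)
Definition ptuple (I : Type) (r : seq I) (X : I -> gsort m)
    (x : forall i, points V (X i)) : points V (sprod r X) :=
  mkpoints (ptuple_subproof r x).

(* A_y = {x in X : (x, y) in A}, for A included in X * Y *)
Definition fiber s t (A : set (points V (s ++ t))) (y : points V t) :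
  set (points V s) := [set x | A (pcat x y)].

End PointOperations.

(* The last two fields:
   - A word l that permutes 0, ..., n-1 induces the coordinate permutation
     (x_0, ..., x_{n-1}) |-> (x_{l_0}, ..., x_{l_{n-1}}). As l ranges over all
     permutations, stability under preimages is stability under images.
   - In Fubini's axiom N is the exceptional null set. The sigma-algebras need
     not be complete, and y |-> mu (A_y) is only well-behaved off N. *)
Record gradedProbSpace (R : realType) (m : nat) (V : 'I_m -> pointedType) := {
  gmeas : forall s : gsort m, set (set (points V s));
  gmeas_sigma : forall s, sigma_algebra setT (@gmeas s);
  gprob : forall s : gsort m, probability (g_sigma_algebraType (@gmeas s)) R;
  gprod : forall (s t : gsort m)
      (A : set (g_sigma_algebraType (@gmeas s) * g_sigma_algebraType (@gmeas t))),
    measurable A ->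
    let A' := [set pcat z.1 z.2 | z in A] in
    gmeas A' /\ gprob (s ++ t) A' = (gprob s \x gprob t)%E A;
  gperm : forall (s : gsort m) (l : seq nat) (A : set (points V (select l s))),
    perm_eq l (iota 0 (size s)) -> gmeas A ->
    let A' := [set x : points V s | A (pselect l x)] in
    gmeas A' /\ gprob s A' = gprob (select l s) A;
  gfubini : forall (s t : gsort m) (A : set (points V (s ++ t))),
    gmeas A ->
    exists N : set (g_sigma_algebraType (@gmeas t)),
      [/\ measurable N,
          gprob t N = 0%E,
          forall y, ~ N y -> gmeas (fiber A y),
          measurable_fun (~` N) (fun y => gprob s (fiber A y)) &
          gprob (s ++ t) A = (\int[gprob t]_(y in ~` N) gprob s (fiber A y))%E]
}.
Arguments gmeas {R m V} g s.
Arguments gprob {R m V} g s.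

(* 0-1 words of length n, resp. of length < n *)
Fixpoint words (n : nat) : seq (seq bool) :=
  if n is n'.+1 then [seq b :: w | b <- [:: false; true], w <- words n']
  else [:: [::]].

Definition short_words (n : nat) : seq (seq bool) :=
  flatten [seq words i | i <- iota 0 n].

Section Stability.
Context {R : realType} {m : nat} {V : 'I_m -> pointedType}.
Variable G : gradedProbSpace R V.

Definition tree_sort (s t : gsort m) (d : nat) : gsort m :=
  sprod (words d) (fun=> s) ++ sprod (short_words d) (fun=> t).

(* Only the values of a on words d and of b on short_words d matter. *)
Definition tree (s t : gsort m) (Q : set (points V (s ++ t))) (d : nat) :
    set (points V (tree_sort s t d)) :=
  [set z | exists (a : seq bool -> points V s) (b : seq bool -> points V t),
    z = pcat (ptuple (words d) a) (ptuple (short_words d) b) /\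
    forall (w : seq bool) (i : nat), size w = d -> (i < d)%N ->
      Q (pcat (a w) (b (take i w))) <-> nth false w i = true].

Arguments tree [s t] Q d.

Definition mu_stable (s t : gsort m) (Q : set (points V (s ++ t))) (d : nat) :=
  gprob G (tree_sort s t d) (tree Q d) = 0%E.

(* The binary relation on X_l * \prod_(i != l) X_i obtained from E by moving
   the block l to the front. *)
Definition split_at (k : nat) (X : 'I_k -> gsort m) (l : 'I_k)
    (E : set (points V (sprod (enum 'I_k) X))) :
    set (points V (X l ++ sprod [seq i <- enum 'I_k | i != l] X)) :=
  [set pcat (x l) (ptuple [seq i <- enum 'I_k | i != l] x)
    | x in [set x : forall i, points V (X i) | E (ptuple (enum 'I_k) x)]].

Arguments split_at {k X} l E.

Definition partition_wise_mu_stable (k : nat) (X : 'I_k -> gsort m)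
    (E : set (points V (sprod (enum 'I_k) X))) :=
  exists2 d : nat, (1 <= d)%N & forall l : 'I_k, mu_stable (split_at l E) d.

End Stability.

(* For a subset I of the positions of s: the increasing word of its elements. *)
Definition positions (n : nat) (I : {set 'I_n}) : seq nat :=
  [seq nat_of_ord i | i <- enum I].

Section FiberAlgebra.
Context {m : nat} {V : 'I_m -> pointedType}.

Definition subsort (s : gsort m) (I : {set 'I_(size s)}) : gsort m :=
  select (positions I) s.

Definition prestrict (s : gsort m) (I : {set 'I_(size s)}) (x : points V s) :
  points V (subsort I) := pselect (positions I) x.

Variables (W : gsort m) (E : set (points V W)).

(* The fiber E_b in W_I, for b in W_{~I}. *)
Definition coord_fiber (I : {set 'I_(size W)}) (b : points V (subsort (~: I))) :
    set (points V (subsort I)) :=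
  [set prestrict I w
    | w in [set w : points V W | E w /\ prestrict (~: I) w = b]].

Arguments coord_fiber : clear implicits.

Definition fibers0 (I : {set 'I_(size W)}) : set (set (points V (subsort I))) :=
  [set F | exists b, F = coord_fiber I b \/ F = ~` coord_fiber I b].

Arguments fibers0 : clear implicits.

(* F^{E,N}_S. The equation e says (j_t : t in J_l) = (i_t : t in I_l), and
   allows (b_i : i in J_l) to be read as a point of W_{I_l}. *)
Definition fiber_intersections (S : gsort m) (N : nat) : set (set (points V S)) :=
  [set D | exists (J : 'I_N -> {set 'I_(size S)})
      (I : 'I_N -> {set 'I_(size W)})
      (e : forall l, subsort (J l) = subsort (I l))
      (F : forall l, set (points V (subsort (I l)))),
    (forall l, fibers0 (I l) (F l)) /\
    D = [set b | forall l,
          F l (ecast s (points V s) (e l) (prestrict (J l) b))]].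

Arguments fiber_intersections : clear implicits.

Definition fiber_sigma_algebra (S : gsort m) : set (set (points V S)) :=
  <<s \bigcup_N fiber_intersections S N >>.

End FiberAlgebra.

Arguments fibers0 {m V W} E I.
Arguments fiber_sigma_algebra {m V W} E S.

Section Regularity.
Context {R : realType} {m : nat} {V : 'I_m -> pointedType}.
Variable G : gradedProbSpace R V.

Definition measurable_fibers (W : gsort m) (E : set (points V W)) :=
  forall (I : {set 'I_(size W)}) (F : set (points V (subsort I))),
    fibers0 E I F -> gmeas G (subsort I) F.

Section Box.
Context {k : nat} {X : 'I_k -> gsort m}.

Definition box (A : forall t, set (points V (X t))) :
    set (points V (sprod (enum 'I_k) X)) :=
  [set ptuple (enum 'I_k) x
    | x in [set x : forall t, points V (X t) | forall t, A t (x t)]].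

(* Pieces of the partition are allowed to be empty, so that finite partitions
   are covered. *)
Definition definable_perfect_stable_regularity
    (E : set (points V (sprod (enum 'I_k) X))) :=
  exists A : forall t : 'I_k, nat -> set (points V (X t)),
    (forall t : 'I_k,
      [/\ \bigcup_i A t i = setT,
          trivIset setT (A t) &
          forall i, fiber_sigma_algebra E (X t) (A t i)]) /\
    forall i : 'I_k -> nat,
      let B := box (fun t => A t (i t)) in
      let P := fun C => fine (gprob G (sprod (enum 'I_k) X) C) in
      P B != 0 -> P (E `&` B) / P B = 0 \/ P (E `&` B) / P B = 1.

End Box.
End Regularity.

(* Main.v *)
(* Fix a block t and view E as a binary relation on X_t * Y_t. Let A, of positive
   measure, belong to the sigma-algebra generated by the fibers E_y. If no subset
   of A of positive measure in this sigma-algebra is perfect, then for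
   non-negligibly many y the fiber E_y splits A into two parts of positive
   measure, which again have no such perfect subset. By induction on d and
   Fubini, the trees of height d with leaves in A have positive measure, which
   contradicts stability. Hence a maximality argument covers X_t, up to a null
   set, by countably many perfect sets.

   For a box B with perfect sides, draw x and x' independently in the product of
   the X_t, and suppose that x is in E and B, and x' in B but not in E. Replacing
   the blocks of x by those of x' one by one, some step leaves E. Perfection of
   the corresponding side makes each such step a null event, by Fubini. Hence
   mu (E & B) * mu (B \ E) = 0. *)
Require Import Defs.
From mathcomp Require Import all_boot all_order all_algebra.
From mathcomp Require Import all_classical all_reals all_analysis.
From mathcomp Require Import measurable_realfun.

(** * Rearranging the blocks of a flattened sequence *)

Section BlockSelection.
Set Implicit Arguments.
Unset Strict Implicit.

Lemma select_cat (T : Type) (l1 l2 : seq nat) (z : seq T) :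
  select (l1 ++ l2) z = select l1 z ++ select l2 z.
Proof. exact: pmap_cat. Qed.

Lemma select_flatten (T : Type) (ls : seq (seq nat)) (z : seq T) :
  select (flatten ls) z = flatten [seq select l z | l <- ls].
Proof. by elim: ls => //= l ls IH; rewrite select_cat IH. Qed.

Lemma select_iota (T : Type) (a b : nat) (z : seq T) :
  select (iota a b) z = take b (drop a z).
Proof.
elim: b a => [|b IH] a; first by rewrite take0.
rewrite /= /select /= -/(select _ _) IH.
have [za|az] := leqP (size z) a.
  by rewrite onth_default ?drop_oversize ?(leq_trans za).
case: z az {IH} => // y z' az.
by rewrite (drop_nth y az) /= -[a in onth _ a]/(a) onthE (nth_map y).
Qed.

(** Cut [iota 0 N] into consecutive blocks of lengths [n i] along [r] and list them in the order of
    [r']. The result depends only on the lengths, so one coordinate permutation serves both points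
    and their sorts. *)
Lemma block_selection (I : eqType) (n : I -> nat) (r r' : seq I) :
  perm_eq r' r ->
  exists2 l : seq nat, perm_eq l (iota 0 (sumn (map n r))) &
    forall (U : Type) (f : I -> seq U), (forall i, size (f i) = n i) ->
      select l (flatten (map f r)) = flatten (map f r').
Proof.
case: r => [/perm_nilP -> | x0 r0]; first by exists [::].
move: (x0 :: r0) => {r0} r; set N := sumn _.
case/(perm_iotaP x0) => Is pIs ->.
pose bs := reshape (map n r) (iota 0 N).
have sbs : size bs = size r by rewrite size_reshape size_map.
exists (flatten (map (nth [::] bs) Is)).
  have <- : flatten bs = iota 0 N by rewrite reshapeKr// size_iota.
  apply: perm_flatten; apply: perm_trans (perm_map _ pIs) _.
  by rewrite -sbs map_nth_iota0// take_size.
move=> U f fn; rewrite select_flatten -!map_comp; congr flatten.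
have sh : map n r = shape (map f r).
  by rewrite /shape -map_comp; apply: eq_map => i /=.
apply/eq_in_map => j; rewrite (perm_mem pIs) mem_iota add0n => /andP[_ jr] /=.
rewrite -(nth_map _ [::]) // -[in RHS](flattenK (map f r)) -sh nth_reshape.
set z := flatten _; have sz : size z = N by rewrite size_flatten -sh.
rewrite nth_reshape drop_iota take_iota add0n select_iota.
(* The block of indices may be cut off at [N], but [drop a z] ends there too. *)
set a := sumn _; set b := nth _ _ _; have [//|ab] := leqP b.
by rewrite !take_oversize// size_drop sz // ltnW.
Qed.

End BlockSelection.

(** * Measure and Fubini on sets of untyped sequences *)

Section GradedMeasure.
Set Implicit Arguments.
Unset Strict Implicit.
Local Open Scope classical_set_scope.
Local Open Scope ring_scope.
Import Order.TTheory GRing.Theory Num.Theory.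
Context {R : realType} {m : nat} {V : 'I_m -> pointedType}.
Variable G : gradedProbSpace R V.
Implicit Types s t : gsort m.

(* Working with sets of untyped sequences avoids casts between sorts that are
   only provably equal. *)
Definition lift s (P : set (seq {i : 'I_m & V i})) : set (points V s) :=
  [set x | P (val x)].
Arguments lift s P : clear implicits.

Lemma size_pval s (x : points V s) : size (val x) = size s.
Proof. by have /eqP/(congr1 size) := valP x; rewrite size_map. Qed.

Lemma lift_val s (A : set (points V s)) : A = lift s [set val x | x in A].
Proof.
apply/seteqP; split=> x /=; first by exists x.
by move=> [y Ay /val_inj <-].
Qed.

Lemma gmeasE s :
  (measurable : set (set (g_sigma_algebraType (gmeas G s)))) = gmeas G s.
Proof. exact: measurable_g_measurableTypeE (gmeas_sigma G s). Qed.

Lemma gmeas_measurable s (A : set (g_sigma_algebraType (gmeas G s))) :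
  gmeas G s A -> measurable A.
Proof. by rewrite gmeasE. Qed.

Lemma gmeasT s : gmeas G s setT.
Proof. by rewrite -gmeasE; exact: measurableT. Qed.

Lemma gmeas0 s : gmeas G s set0.
Proof. by rewrite -gmeasE; exact: measurable0. Qed.

Lemma gmeasC s A : gmeas G s A -> gmeas G s (~` A).
Proof. by rewrite -gmeasE; exact: measurableC. Qed.

Lemma gmeasI s A B : gmeas G s A -> gmeas G s B -> gmeas G s (A `&` B).
Proof. by rewrite -gmeasE; exact: measurableI. Qed.

Lemma gmeasD s A B : gmeas G s A -> gmeas G s B -> gmeas G s (A `\` B).
Proof. by rewrite -gmeasE; exact: measurableD. Qed.

Lemma gprob_le s A B : gmeas G s A -> gmeas G s B -> A `<=` B ->
  (gprob G s A <= gprob G s B)%E.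
Proof.
move=> /gmeas_measurable mA /gmeas_measurable mB AB.
by apply: (@le_measure _ _ _ (gprob G s)); rewrite ?inE.
Qed.

Lemma gprob_null_sub s A B : gmeas G s A -> gmeas G s B -> A `<=` B ->
  gprob G s B = 0%E -> gprob G s A = 0%E.
Proof.
by move=> mA mB AB B0; apply/eqP; rewrite eq_le -{1}B0 gprob_le ?measure_ge0.
Qed.

Lemma gprob_nullU s A B : gmeas G s A -> gmeas G s B ->
  gprob G s A = 0%E -> gprob G s B = 0%E -> gprob G s (A `|` B) = 0%E.
Proof.
by move=> /gmeas_measurable mA /gmeas_measurable mB; exact: null_set_setU.
Qed.

Lemma lift_prod s t P Q :
  gmeas G s (lift s P) -> gmeas G t (lift t Q) ->
  let PQ := lift (s ++ t)
    [set z | P (take (size s) z) /\ Q (drop (size s) z)] in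
  gmeas G (s ++ t) PQ /\
  gprob G (s ++ t) PQ = (gprob G s (lift s P) * gprob G t (lift t Q))%E.
Proof.
move=> mP mQ /=; set PQ := lift _ _.
have PQE : PQ = [set pcat z.1 z.2 | z in lift s P `*` lift t Q].
  apply/seteqP; split=> [z [Pz Qz]|_ [[x y] [Px Qy] <-]] /=; last first.
    by split=> /=; rewrite -(size_pval x) ?take_size_cat ?drop_size_cat.
  have zs : map tag (take (size s) (val z)) = s.
    by rewrite map_take (eqP (valP z)) take_size_cat.
  have zt : map tag (drop (size s) (val z)) = t.
    by rewrite map_drop (eqP (valP z)) drop_size_cat.
  exists (mkpoints zs, mkpoints zt) => //.
  by apply: val_inj; rewrite /= cat_take_drop.
move: mP mQ => /gmeas_measurable mP /gmeas_measurable mQ.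
have /= := gprod (measurableX mP mQ); rewrite -PQE => -[mA ->].
by rewrite product_measure1E.
Qed.

(** The sort [s'] is a variable with an equation, so that a sort only provably equal to the
    selection can be used without casts. *)
Lemma lift_select s s' (l : seq nat) P :
  perm_eq l (iota 0 (size s)) -> s' = select l s -> gmeas G s' (lift s' P) ->
  gmeas G s (lift s [set z | P (select l z)]) /\
  gprob G s (lift s [set z | P (select l z)]) = gprob G s' (lift s' P).
Proof. by move=> pl -> mP; have := gperm pl mP. Qed.

(** By Fubini the measure is an integral of fiber measures, and a nonnegative function has integral
    zero exactly when it vanishes almost everywhere. From left to right, the exceptional set of the
    axiom joins the null set. *)
Lemma gprob_null_fiber s t (A : set (points V (s ++ t))) : gmeas G _ A ->
  gprob G _ A = 0%E <->
  exists N, [/\ gmeas G t N, gprob G t N = 0%E &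
    forall y, ~ N y -> gprob G s (fiber A y) = 0%E].
Proof.
move=> mA; have [N [mN N0 mf f_meas ->]] := gfubini mA.
have := ae_eq_integral_abs (gprob G t) (measurableC mN) f_meas.
under eq_integral do rewrite gee0_abs ?measure_ge0//.
move=> ->; split => [[M [mM M0 MP]]|[M [mM M0 MP]]].
  exists (N `|` M); split.
  - by rewrite -gmeasE; apply: measurableU.
  - exact: null_set_setU.
  move=> y /not_orP[Ny My]; apply: contrapT => fy; apply: My; apply: MP => /=.
  by move/(_ Ny).
exists M; split=> //; first by rewrite gmeasE.
move=> y /= /not_implyP[Ny fy]; apply: contrapT => My; apply: fy.
exact: MP.
Qed.

End GradedMeasure.
Arguments lift {m V} s P.

(** * Events in a finite product of blocks *)

Section Events.
Set Implicit Arguments.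
Unset Strict Implicit.
Local Open Scope classical_set_scope.
Local Open Scope ring_scope.
Import Order.TTheory GRing.Theory Num.Theory.
Context {R : realType} {m : nat} {V : 'I_m -> pointedType}.
Variable G : gradedProbSpace R V.
Context {I : eqType} (X : I -> gsort m).
Implicit Types (r : seq I) (x : forall i, points V (X i)).
Implicit Types (Q : set (forall i, points V (X i))).

(* The coordinates of a point of \prod_(i in r) X i, extended arbitrarily
   outside r. *)
Definition unptuple r (z : seq {i : 'I_m & V i}) : forall i, points V (X i) :=
  fun i => insubd (point : points V (X i))
    (nth [::] (reshape [seq size (X j) | j <- r] z) (index i r)).
Arguments unptuple r z i : clear implicits.

Lemma unptupleK r x i : i \in r -> unptuple r (val (ptuple r x)) i = x i.
Proof.
move=> ir; rewrite /unptuple /=.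
have -> : [seq size (X j) | j <- r] = shape [seq val (x j) | j <- r].
  by rewrite /shape -map_comp; apply: eq_map => j /=; rewrite size_pval.
by rewrite flattenK (nth_map i) ?index_mem// nth_index// valKd.
Qed.

Lemma ptuple_unptuple r (z : points V (sprod r X)) :
  uniq r -> ptuple r (unptuple r (val z)) = z.
Proof.
move=> ur; apply: val_inj => /=; set sh := [seq size (X j) | j <- r].
have sz : size (val z) = sumn sh.
  by rewrite size_pval size_flatten /shape -map_comp.
rewrite -[RHS](@reshapeKr _ sh) ?sz//; congr flatten.
apply: (@eq_from_nth _ [::]); first by rewrite size_reshape !size_map.
move=> j; rewrite size_map => jr.
have i0 : I by case: (r) jr.
rewrite (nth_map i0)// /unptuple index_uniq// insubdK//= unfold_in.
(* The block spells its sort, since cutting commutes with taking tags; hence [insubd] does not fall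
   back on its default value. *)
apply/eqP; rewrite -(nth_map [::] [::] (map tag)) ?size_reshape ?size_map//.
rewrite map_reshape (eqP (valP z)) /sprod.
rewrite -/sh; have -> : sh = shape [seq X i | i <- r] by rewrite /shape -map_comp.
by rewrite flattenK (nth_map i0).
Qed.

(** [Q] speaks of a whole family, so one [Q] can be measured over different words [r] of
    coordinates. *)
Definition event r Q : set (points V (sprod r X)) :=
  lift (sprod r X) [set z | Q (unptuple r z)].
Arguments event r Q : clear implicits.

(** For such [Q] the arbitrary values of [unptuple] outside [r] do not affect [event r Q]. *)
Definition local r Q :=
  forall x x', (forall i, i \in r -> x i = x' i) -> Q x -> Q x'.
Arguments local r Q : clear implicits.

Lemma local_sub r r' Q : {subset r <= r'} -> local r Q -> local r' Q.
Proof. by move=> rr' lQ x x' xx'; apply: lQ => i /rr'; exact: xx'. Qed.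

Lemma event_ptuple r Q x : local r Q -> event r Q (ptuple r x) <-> Q x.
Proof.
by move=> lQ; split; apply: lQ => i ir; rewrite unptupleK.
Qed.

Lemma eventE r Q : uniq r -> local r Q -> event r Q = [set ptuple r x | x in Q].
Proof.
move=> ur lQ; apply/seteqP; split=> [z Qz|_ [x Qx <-]].
  by exists (unptuple r (val z)) => //; rewrite ptuple_unptuple.
exact/event_ptuple.
Qed.

Definition measurable_on r Q := local r Q /\ gmeas G _ (event r Q).
Arguments measurable_on r Q : clear implicits.

Lemma measurable_onI r Q Q' :
  measurable_on r Q -> measurable_on r Q' -> measurable_on r (Q `&` Q').
Proof.
move=> [lQ mQ] [lQ' mQ']; split; last exact: gmeasI mQ mQ'.
by move=> x x' xx' [/(lQ _ _ xx') ? /(lQ' _ _ xx') ?].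
Qed.

Lemma measurable_onC r Q : measurable_on r Q -> measurable_on r (~` Q).
Proof.
move=> [lQ mQ]; split; last exact: gmeasC mQ.
by move=> x x' xx' nQx /(lQ _ _ (fun i ir => esym (xx' i ir))).
Qed.

Lemma measurable_on_all (J : eqType) r (l : seq J)
    (Q : J -> set (forall i, points V (X i))) :
  (forall j, j \in l -> measurable_on r (Q j)) ->
  measurable_on r [set x | forall j, j \in l -> Q j x].
Proof.
elim: l => [_|j l IH mQ].
  split=> //; suff -> : event r [set x | forall j, j \in [::] -> Q j x] = setT.
    exact: gmeasT.
  exact/seteqP.
rewrite [X in measurable_on _ X](_ : _ =
    Q j `&` [set x | forall j', j' \in l -> Q j' x]); last first.
  apply/seteqP; split=> [x Qx|x [Qjx Qx]] /=.
    by split=> [|j' j'l]; apply: Qx; rewrite inE ?eqxx ?j'l ?orbT.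
  by move=> j'; rewrite inE => /predU1P[->|/Qx].
apply: measurable_onI; first by apply: mQ; rewrite mem_head.
by apply: IH => j' j'l; apply: mQ; rewrite inE j'l orbT.
Qed.

(** Comparing [A] and [Q] through underlying sequences lets [s] be any sort equal to [sprod r X].
    Sets on a sort, and events indexed otherwise, become events over [r] in this way. *)
Lemma event_of_set s (A : set (points V s)) r Q :
  uniq r -> s = sprod r X ->
  (forall (a : points V s) x,
    val a = flatten [seq val (x i) | i <- r] -> A a <-> Q x) ->
  gmeas G s A ->
  measurable_on r Q /\ gprob G _ (event r Q) = gprob G s A.
Proof.
move=> ur sE; subst s => AQ mA.
have QA : event r Q = A.
  apply/seteqP; split=> z; have zE := congr1 val (ptuple_unptuple z ur).
    by move=> Qz; apply/(AQ _ (unptuple r (val z))).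
  by move=> Az; apply/(AQ z).
rewrite /measurable_on QA; do 2 split=> //.
move=> x x' xx' /(AQ (ptuple r x) x erefl) /AQ; apply => /=; congr flatten.
by apply/eq_in_map => i /xx' ->.
Qed.

(** Adding the missing coordinates multiplies by a full space of measure 1; a block permutation then
    leads to [r']. If both words have the same elements, this is invariance under reordering. *)
Lemma event_widen r r' Q :
  uniq r -> uniq r' -> {subset r <= r'} -> measurable_on r Q ->
  measurable_on r' Q /\ gprob G _ (event r' Q) = gprob G _ (event r Q).
Proof.
move=> ur ur' rr' [lQ mQ]; pose r2 := [seq i <- r' | i \notin r].
have pr : perm_eq (r ++ r2) r'.
  apply: uniq_perm => //.
    rewrite cat_uniq ur filter_uniq// andbT; apply/hasPn => i.
    by rewrite mem_filter => /andP[].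
  move=> i; rewrite mem_cat mem_filter.
  by case: (boolP (i \in r)) => //= /rr' ->.
have [l pl lE] := block_selection (fun i => size (X i)) pr.
have sr' : sumn [seq size (X i) | i <- r'] = size (sprod r' X).
  by rewrite size_flatten /shape -map_comp.
rewrite sr' in pl.
have sl : sprod r X ++ sprod r2 X = select l (sprod r' X).
  by rewrite lE // map_cat flatten_cat.
have mT : gmeas G (sprod r2 X) (lift (sprod r2 X) setT) by exact: gmeasT.
have [m1 p1] := lift_prod mQ mT.
have [m2 p2] := lift_select pl sl m1.
suff QE : event r' Q = lift (sprod r' X) [set z |
    Q (unptuple r (take (size (sprod r X)) (select l z))) /\
    [set: seq {i : 'I_m & V i}] (drop (size (sprod r X)) (select l z))].
  rewrite /measurable_on QE; split; last first.
    by rewrite p2 p1 [X in (_ * X)%E](_ : _ = 1%E) ?mule1//; exact: probability_setT.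
  by split=> //; exact: local_sub lQ.
suff h z : Q (unptuple r (take (size (sprod r X)) (select l (val z)))) <->
    event r' Q z.
  apply/seteqP; split=> z; first by move=> Qz; split=> //; apply/h.
  by move=> [Qz _]; apply/h.
rewrite -(ptuple_unptuple z ur'); move: (unptuple r' (val z)) => x.
rewrite event_ptuple; last exact: local_sub lQ.
rewrite -[val _]/(flatten [seq val (x i) | i <- r']).
rewrite lE; last by move=> i; rewrite size_pval.
rewrite map_cat flatten_cat -[flatten _]/(val (ptuple r x)).
by rewrite -(size_pval (ptuple r x)) take_size_cat//; apply: event_ptuple.
Qed.

Lemma event_cat r r' Q Q' : uniq (r ++ r') ->
  measurable_on r Q -> measurable_on r' Q' ->
  gprob G _ (event (r ++ r') (Q `&` Q')) =
  (gprob G _ (event r Q) * gprob G _ (event r' Q'))%E.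
Proof.
move=> urr' [lQ mQ] [lQ' mQ']; have [mP <-] := lift_prod mQ mQ'.
refine (event_of_set (Q := Q `&` Q') urr' _ _ mP).2.
  by rewrite /sprod map_cat flatten_cat.
move=> a x aE; rewrite /lift /= aE map_cat flatten_cat.
rewrite -[flatten _]/(val (ptuple r x)) -[flatten _]/(val (ptuple r' x)).
rewrite -(size_pval (ptuple r x)) take_size_cat// drop_size_cat//.
have [h1 h2] := event_ptuple x lQ; have [h1' h2'] := event_ptuple x lQ'.
by split=> -[Qx Q'x]; split; [apply: h1|apply: h1'|apply: h2|apply: h2'].
Qed.

(** Fubini for events: a fiber is obtained by overwriting [y] on [r]. The exceptional set consists
    of sequences, so it can be read in any sort equal to [sprod r' X]. *)
Lemma event_null_fiber r r' Q : uniq (r ++ r') -> measurable_on (r ++ r') Q ->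
  gprob G _ (event (r ++ r') Q) = 0%E <->
  exists P, [/\ gmeas G _ (lift (sprod r' X) P),
    gprob G _ (lift (sprod r' X) P) = 0%E &
    forall y : forall i, points V (X i), ~ P (flatten [seq val (y i) | i <- r']) ->
      gprob G _ (event r [set x | Q (fun i => if i \in r then x i else y i)])
        = 0%E].
Proof.
move=> urr' [lQ mQ].
have sE : sprod (r ++ r') X = sprod r X ++ sprod r' X.
  by rewrite /sprod map_cat flatten_cat.
have ur : uniq r by move: urr'; rewrite cat_uniq => /andP[].
(* The same event over a concatenation of two sorts, the form in which fibers are defined. *)
pose A := lift (sprod r X ++ sprod r' X) [set z | Q (unptuple (r ++ r') z)].
have [mA <-] : gmeas G _ A /\ gprob G _ A = gprob G _ (event (r ++ r') Q).
  by rewrite /A -sE.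
have AE (y : forall i, points V (X i)) : fiber A (ptuple r' y) =
    event r [set x | Q (fun i => if i \in r then x i else y i)].
  apply/seteqP; suff h z : fiber A (ptuple r' y) z <->
      event r [set x | Q (fun i => if i \in r then x i else y i)] z.
    by split=> z /h.
  rewrite -(ptuple_unptuple z ur); move: (unptuple r (val z)) => x.
  rewrite event_ptuple => [|x1 x2 x12]; last first.
    by apply: lQ => i _; case: ifPn => // /x12.
  pose xy i := if i \in r then x i else y i.
  rewrite -[X in _ <-> X]/(Q xy) -(event_ptuple xy lQ).
  suff xyE : val (ptuple (r ++ r') xy) = val (pcat (ptuple r x) (ptuple r' y)).
    by rewrite /event /lift /mkset xyE.
  rewrite /= map_cat flatten_cat; congr (flatten _ ++ flatten _).
    by apply/eq_in_map => i ir; rewrite /xy ir.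
  apply/eq_in_map => i ir; rewrite /xy.
  by move: urr'; rewrite cat_uniq => /and3P[_ /hasPn/(_ i ir)/= /negPf ->].
rewrite (gprob_null_fiber mA); split => [[N [mN N0 NA]]|[P [mP P0 PA]]].
  exists [set val x | x in N]; rewrite -lift_val; split=> // y Ny.
  by rewrite -AE; apply: NA => Ny'; apply: Ny; exists (ptuple r' y).
exists (lift (sprod r' X) P); split=> // z Pz.
have ur' : uniq r' by move: urr'; rewrite cat_uniq => /and3P[].
rewrite -(ptuple_unptuple z ur') AE; apply: PA.
by rewrite -[flatten _]/(val (ptuple r' _)) ptuple_unptuple.
Qed.

End Events.
Arguments unptuple {m V I X} r z i.
Arguments event {m V I X} r Q.
Arguments local {m V I X} r Q.
Arguments measurable_on {R m V} G {I X} r Q.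

(** * Trees and perfect sets of a stable relation *)

Section StableRelation.
Set Implicit Arguments.
Unset Strict Implicit.
Local Open Scope classical_set_scope.
Local Open Scope ring_scope.
Import Order.TTheory GRing.Theory Num.Theory.
Context {R : realType} {m : nat} {V : 'I_m -> pointedType}.
Variable G : gradedProbSpace R V.
Context {s t : gsort m}.
Variable Q : set (points V (s ++ t)).
Hypothesis Q_meas : gmeas G (s ++ t) Q.
Hypothesis Q_fibers : forall y, gmeas G s (fiber Q y).

(** Almost every [y] is rendered by a measurable null set [N], since the sigma-algebras need not be
    complete. *)
Definition perfect (A : set (points V s)) :=
  exists N, [/\ gmeas G t N, gprob G t N = 0%E &
    forall y, ~ N y -> gprob G s (A `&` fiber Q y) = 0%E \/
                       gprob G s (A `\` fiber Q y) = 0%E].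

(** All pieces are built in this sigma-algebra; this keeps them measurable and, for a relation split
    off from [E], definable from [E]. *)
Definition fibers_algebra : set (set (points V s)) := <<s range (fiber Q) >>.

Lemma fibers_algebra_gmeas A : fibers_algebra A -> gmeas G s A.
Proof.
apply: smallest_sub; first exact: gmeas_sigma.
by move=> _ [y _ <-]; exact: Q_fibers.
Qed.

Lemma fibers_algebra_fiber y : fibers_algebra (fiber Q y).
Proof. by apply: sub_sigma_algebra; exists y. Qed.

(* Leaves of the tree are indexed by [inl], inner nodes by [inr]. *)
Definition tree_block (i : seq bool + seq bool) : gsort m :=
  if i is inl _ then s else t.

Definition graft (c : bool) (i : seq bool + seq bool) : seq bool + seq bool :=
  match i with inl w => inl (c :: w) | inr w => inr (c :: w) end.

(** In each case the value is [x (graft c i)]; the case distinction makes the types agree by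
    computation. *)
Definition subtree (c : bool) (x : forall i, points V (tree_block i)) :
    forall i, points V (tree_block i) :=
  fun i => match i with inl w => x (inl (c :: w)) | inr w => x (inr (c :: w)) end.

(* The root is placed last, where Fubini's axiom integrates first. *)
Fixpoint tree_index (d : nat) : seq (seq bool + seq bool) :=
  if d is d'.+1 then
    ([seq graft false i | i <- tree_index d'] ++
     [seq graft true i | i <- tree_index d']) ++ [:: inr [::]]
  else [:: inl [::]].

(** Restricting the leaves to [A] lets the induction on the height pass from [A] to its two
    parts. *)
Definition in_tree (A : set (points V s)) (d : nat) :
    set (forall i, points V (tree_block i)) :=
  [set x : forall i, points V (tree_block i) |
    (forall w, size w = d -> A (x (inl w))) /\
    forall w i, size w = d -> (i < d)%N ->
      Q (pcat (x (inl w)) (x (inr (take i w)))) <-> nth false w i = true].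

Lemma graft_inj c : injective (graft c).
Proof. by move=> [u|u] [v|v] //= [->]. Qed.

Lemma mem_graft c i r :
  (i \in [seq graft c j | j <- r]) =
  match i with
  | inl w => if w is b :: w' then (b == c) && (inl w' \in r) else false
  | inr w => if w is b :: w' then (b == c) && (inr w' \in r) else false
  end.
Proof.
apply/mapP/idP => [[[u|u] ur ->] /=|]; rewrite ?eqxx ?ur//.
by case: i => -[|b w]//= /andP[/eqP-> wr]; [exists (inl w)|exists (inr w)].
Qed.

Lemma mem_tree_index d i : (i \in tree_index d) =
  match i with inl w => size w == d | inr w => (size w < d)%N end.
Proof.
elim: d i => [|d IH] i; first by case: i => -[].
rewrite /= !mem_cat !mem_graft mem_seq1.
by case: i => -[|[] w]//=; rewrite !IH ?eqSS ?orbF.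
Qed.

Lemma tree_index_uniq d : uniq (tree_index d).
Proof.
elim: d => //= d IH; rewrite !cat_uniq !map_inj_uniq ?IH//; try exact: graft_inj.
rewrite /= andbT orbF; apply/andP; split.
  by apply/hasPn => i; rewrite !mem_graft; case: i => -[|[] w].
by rewrite mem_cat !mem_graft.
Qed.

(** The first letter of a leaf tells its side of the fiber over the root; the other letters give the
    conditions of the subtree on that side. *)
Lemma in_treeS A d x : in_tree A d.+1 x <->
  in_tree (A `\` fiber Q (x (inr [::]))) d (subtree false x) /\
  in_tree (A `&` fiber Q (x (inr [::]))) d (subtree true x).
Proof.
split=> [[xA xQ]|[[fA fQ] [tA tQ]]].
  split; split=> /= [w wd|w i wd id].
  - split; first by apply: xA; rewrite /= wd.
    by have /= := xQ (false :: w) 0%N; rewrite wd => /(_ erefl erefl)[h _] /h.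
  - by have /= := xQ (false :: w) i.+1; rewrite wd; apply.
  - split; first by apply: xA; rewrite /= wd.
    by have /= := xQ (true :: w) 0%N; rewrite wd => /(_ erefl erefl)[_]; apply.
  - by have /= := xQ (true :: w) i.+1; rewrite wd; apply.
split=> [[//|[] w] /= [wd]|[//|[] w] [|i] /= [wd] id].
- by have [] := tA w wd.
- by have [] := fA w wd.
- by have [] := tA w wd.
- exact: tQ.
- by have [_ nQ] := fA w wd.
- exact: fQ.
Qed.

Lemma mem_words d w : (w \in words d) = (size w == d).
Proof.
elim: d w => [|d IH] w; first by case: w.
rewrite -[words _]/[seq b :: v | b <- [:: false; true], v <- words d].
apply/allpairsP/idP => [[[c v] /=]|].
  by rewrite IH => -[_ /eqP <- ->].
case: w => // b w; rewrite eqSS => wd; exists (b, w); rewrite IH.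
by split=> //; case: b.
Qed.

(** There are finitely many conditions, each on one or two coordinates; an edge condition is [Q] or
    its complement according to the letter. *)
Lemma in_tree_measurable A d : gmeas G s A ->
  measurable_on G (tree_index d) (in_tree A d).
Proof.
move=> mA.
pose leafA w : set (forall i, points V (tree_block i)) := 
    [set x : forall i, points V (tree_block i) | A (x (inl w))].
pose edge w i : set (forall i, points V (tree_block i)) :=
  [set x : forall i, points V (tree_block i) |
    Q (pcat (x (inl w)) (x (inr (take i w)))) <-> nth false w i = true].
rewrite [in_tree A d](_ : _ = [set x | forall w, w \in words d ->
  (leafA w `&` [set x | forall i, i \in iota 0 d -> edge w i x]) x]); last first.
  apply/seteqP; split=> x.
    move=> [xA xQ] w; rewrite mem_words => /eqP wd; split; first exact: xA.
    by move=> i; rewrite mem_iota => id; exact: xQ.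
  move=> xw; split=> [w wd|w i wd id]; have := xw w; rewrite mem_words wd eqxx.
    by move=> /(_ erefl)[].
  by move=> /(_ erefl)[_ /(_ i)]; rewrite mem_iota id => /(_ erefl).
apply: measurable_on_all => w; rewrite mem_words => /eqP wd.
apply: measurable_onI.
  have [|||//|mw _] := @event_of_set _ _ _ G _ tree_block s A [:: inl w] (leafA w).
  - by [].
  - by rewrite /sprod /= cats0.
  - move=> a x; rewrite /= cats0 => /val_inj ->; exact: iff_refl.
  by apply: (event_widen _ (tree_index_uniq d) _ mw).1 => // i;
    rewrite inE => /eqP ->; rewrite mem_tree_index wd.
apply: measurable_on_all => i; rewrite mem_iota => /andP[_ id].
pose e : set (forall i, points V (tree_block i)) :=
  [set x : forall i, points V (tree_block i) |
    Q (pcat (x (inl w)) (x (inr (take i w))))].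
have me : measurable_on G (tree_index d) e.
  have [|||//|mw _] := @event_of_set _ _ _ G _ tree_block _ Q
     [:: inl w; inr (take i w)] e.
  - by [].
  - by rewrite /sprod /= cats0.
  - move=> a x; rewrite /= cats0 => aE.
    suff -> : a = pcat (x (inl w)) (x (inr (take i w))) by [].
    exact: val_inj.
  apply: (event_widen _ (tree_index_uniq d) _ mw).1 => // j.
  rewrite !inE => /orP[] /eqP ->; rewrite mem_tree_index ?wd//.
  by rewrite size_takel ?wd// ltnW.
case wi : (nth false w i).
  suff -> : edge w i = e by [].
  by apply/seteqP; split=> x; rewrite /edge /= wi; [move=> [_]; apply|split].
suff -> : edge w i = ~` e by exact: measurable_onC.
by apply/seteqP; split=> x; rewrite /edge /= wi; [move=> [ex _] /ex|split].
Qed.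

Lemma event_graft c d F : measurable_on G (tree_index d) F ->
  measurable_on G [seq graft c i | i <- tree_index d] (F \o subtree c) /\
  gprob G _ (event [seq graft c i | i <- tree_index d] (F \o subtree c)) =
  gprob G _ (event (tree_index d) F).
Proof.
move=> [lF mF]; apply: event_of_set mF.
- by rewrite map_inj_uniq ?tree_index_uniq//; exact: graft_inj.
- by rewrite /sprod -map_comp; congr flatten; apply: eq_map => -[].
move=> a x aE; rewrite -[(F \o _) x]/(F (subtree c x)) -(event_ptuple _ lF).
suff -> : a = ptuple (tree_index d) (subtree c x) by exact: iff_refl.
apply: val_inj; rewrite aE /= -map_comp; congr flatten.
by apply: eq_map => -[].
Qed.

Definition no_perfect_subset (A : set (points V s)) :=
  forall P, fibers_algebra P -> P `<=` A -> perfect P -> gprob G s P = 0%E.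

(** For almost every root the two subtrees are independent, so one of them is null, and by induction
    so is one of the two parts of [A]. Then [A] itself is perfect, hence null. For [d = 0] the tree
    is a single leaf in [A]. *)
Lemma no_perfect_subset_null d A : fibers_algebra A -> no_perfect_subset A ->
  gprob G _ (event (tree_index d) (in_tree A d)) = 0%E -> gprob G s A = 0%E.
Proof.
elim: d A => [|d IH] A fA nA.
  have mA := fibers_algebra_gmeas fA.
  have [|||//|_ ->//] := @event_of_set _ _ _ G _ tree_block s A [:: inl [::]]
    (in_tree A 0).
  - by [].
  - by rewrite /sprod /= cats0.
  - move=> a x; rewrite /= cats0 => /val_inj ->; split=> [Ax|[xA _]].
      by split=> // w /size0nil ->.
    exact: xA.
have mA := fibers_algebra_gmeas fA.
rewrite event_null_fiber; [|exact: (tree_index_uniq d.+1)|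
  exact: (in_tree_measurable d.+1)].
set r0 := [seq graft false i | i <- tree_index d].
set r1 := [seq graft true i | i <- tree_index d].
have -> : sprod [:: inr [::]] tree_block = t by rewrite /sprod /= cats0.
move=> [P [mP P0 PA]].
apply: (nA A) => //; exists (lift t P); split=> // y0 Py0.
pose y (i : seq bool + seq bool) : points V (tree_block i) :=
  if i is inr _ then y0 else point.
have /(PA y) : ~ P (flatten [seq val (y i) | i <- [:: inr [::]]]).
  by rewrite /= cats0.
have mA1 := in_tree_measurable d (gmeasI mA (Q_fibers y0)).
have mA0 := in_tree_measurable d (gmeasD mA (Q_fibers y0)).
have [m0 e0] := event_graft false mA0; have [m1 e1] := event_graft true mA1.
have u01 : uniq (r0 ++ r1).
  by have /= := tree_index_uniq d.+1; rewrite cat_uniq => /andP[].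
(* With the root fixed at [y0], the event splits into one condition per subtree, on disjoint
   coordinates. *)
rewrite [X in event _ X](_ : _ =
  (in_tree (A `\` fiber Q y0) d \o subtree false) `&`
  (in_tree (A `&` fiber Q y0) d \o subtree true)); last first.
  apply/seteqP; suff h x : in_tree A d.+1 (fun i =>
      if i \in r0 ++ r1 then x i else y i) <->
      in_tree (A `\` fiber Q y0) d (subtree false x) /\
      in_tree (A `&` fiber Q y0) d (subtree true x).
    by split=> x /h.
  rewrite in_treeS mem_cat !mem_graft.
  have agree c i : i \in tree_index d -> subtree c
      (fun i => if i \in r0 ++ r1 then x i else y i) i = subtree c x i.
    by case: i c => w [] wd /=; rewrite mem_cat !mem_graft ?wd ?orbT.
  split=> -[x0 x1]; split; first [apply: mA0.1 x0|apply: mA1.1 x1] => i id;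
    by rewrite agree.
rewrite event_cat// e0 e1 => /eqP; rewrite mule_eq0 => /orP[] /eqP.
  move=> /IH h; right; apply: h.
    exact: (@measurableD _ (g_sigma_algebraType _)) fA (fibers_algebra_fiber y0).
  by move=> B fB BA; apply: nA => //; exact: subset_trans BA (@subDsetl _ _ _).
move=> /IH h; left; apply: h.
  exact: (@measurableI _ (g_sigma_algebraType _)) fA (fibers_algebra_fiber y0).
by move=> B fB BA; apply: nA => //; exact: subset_trans BA (@subIsetl _ _ _).
Qed.

Lemma mem_short_words d w : (w \in short_words d) = (size w < d)%N.
Proof.
apply/flatten_mapP/idP => [[i]|wd].
  by rewrite mem_iota add0n mem_words => /andP[_ id] /eqP ->.
by exists (size w); rewrite ?mem_iota ?mem_words//=.
Qed.

Lemma words_uniq d : uniq (words d).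
Proof.
elim: d => // d IH; rewrite /= cats0 cat_uniq !map_inj_uniq ?IH ?andbT /=; last 2 first.
- by move=> u v [].
- by move=> u v [].
by apply/hasPn => _ /mapP[u _ ->]; apply/mapP => -[].
Qed.

Lemma short_words_uniq d : uniq (short_words d).
Proof.
elim: d => // d IH.
have -> : short_words d.+1 = short_words d ++ words d.
  by rewrite /short_words -addn1 iotaD map_cat flatten_cat /= cats0.
rewrite cat_uniq IH words_uniq andbT; apply/hasPn => w.
by rewrite mem_words mem_short_words => /eqP ->; rewrite ltnn.
Qed.

(** Both sides list the same indices in different orders, and [event_widen] makes the measure
    independent of the order. *)
Lemma gprob_tree d : gprob G _ (tree Q (d:=d)) =
  gprob G _ (event (tree_index d) (in_tree setT d)).
Proof.
pose r : seq (seq bool + seq bool) := map inl (words d) ++ map inr (short_words d).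
have mr i : (i \in r) = (i \in tree_index d).
  rewrite mem_tree_index mem_cat; case: i => w.
    rewrite mem_map ?mem_words; last by move=> u v [].
    by case: eqP => //= _; apply/mapP => -[].
  rewrite orbC mem_map ?mem_short_words; last by move=> u v [].
  by case: ltnP => //= _; apply/mapP => -[].
have ur : uniq r.
  rewrite cat_uniq !map_inj_uniq ?words_uniq ?short_words_uniq ?andbT//=;
    try by move=> u v [].
  by apply/hasPn => _ /mapP[u _ ->]; apply/mapP => -[].
have mT := in_tree_measurable d (gmeasT G s).
have [|[lr _] <-] := event_widen (tree_index_uniq d) ur _ mT.
  by move=> i; rewrite mr.
have rE : tree_sort s t d = sprod r tree_block.
  by rewrite /tree_sort /sprod map_cat flatten_cat -!map_comp.
suff -> : tree Q (d:=d) = lift _ [set z | in_tree setT d (unptuple r z)].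
  by rewrite rE.
apply/seteqP; split=> z.
  move=> [a [b [-> ab]]].
  pose x (i : seq bool + seq bool) : points V (tree_block i) :=
    match i with inl w => a w | inr w => b w end.
  have /(event_ptuple _ lr) : in_tree setT d x by [].
  by rewrite /event /lift /= map_cat flatten_cat -!map_comp.
pose x : forall i, points V (tree_block i) := unptuple r (val z).
move=> xt; have {xt} : in_tree setT d x := xt.
move=> xt.
exists (fun w => x (inl w)), (fun w => x (inr w)); split; last exact: xt.2.
have zr : map tag (val z) = sprod r tree_block by rewrite -rE (eqP (valP z)).
apply: val_inj; rewrite -[LHS]/(val (mkpoints zr)).
rewrite -(ptuple_unptuple (mkpoints zr) ur) /=.
by rewrite map_cat flatten_cat -!map_comp.
Qed.

(** * Exhausting a sort by perfect sets *)

Lemma perfect_sub A B : gmeas G s A -> gmeas G s B -> A `<=` B ->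
  perfect B -> perfect A.
Proof.
move=> mA mB AB [N [mN N0 BN]]; exists N; split=> // y /BN[] B0; [left|right].
  by apply: gprob_null_sub B0; [exact: gmeasI|exact: gmeasI|exact: setSI].
by apply: gprob_null_sub B0; [exact: gmeasD|exact: gmeasD|exact: setSD].
Qed.

Lemma perfect_null A : gmeas G s A -> gprob G s A = 0%E -> perfect A.
Proof.
move=> mA A0; exists set0; split=> [||y _]; [exact: gmeas0|exact: measure0|left].
by apply: gprob_null_sub A0 => //; exact: gmeasI.
Qed.

(** Trees with leaves in [A] are among all trees, so stability makes them null. *)
Lemma mu_stable_perfect_subset d A : mu_stable G Q d ->
  fibers_algebra A -> gprob G s A <> 0%E ->
  exists P, [/\ fibers_algebra P, P `<=` A, perfect P & gprob G s P <> 0%E].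
Proof.
move=> Qd fA A0; apply: contrapT => noP; apply: A0.
apply: (@no_perfect_subset_null d) => // [P fP PA pP|].
  by apply: contrapT => P0; apply: noP; exists P.
have mA := fibers_algebra_gmeas fA.
move: Qd; rewrite /mu_stable gprob_tree; apply: gprob_null_sub.
- exact: (in_tree_measurable d mA).2.
- exact: (in_tree_measurable d (gmeasT G s)).2.
- by move=> z [zA zQ]; split=> // w /zA.
Qed.

(** The supremum [c] of the measures of countable unions of perfect sets is attained by merging
    near-optimal sequences. If the complement had positive measure, adding a perfect subset of it
    would exceed [c]. *)
Lemma perfect_exhaustion d : mu_stable G Q d ->
  exists B : nat -> set (points V s),
    (forall n, fibers_algebra (B n) /\ perfect (B n)) /\
    gprob G s (~` \bigcup_n B n) = 0%E.
Proof.
move=> Qd.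
pose good := [set B : nat -> set (points V s) |
  forall n, fibers_algebra (B n) /\ perfect (B n)].
have good_meas B : good B -> fibers_algebra (\bigcup_n B n).
  move=> gB; apply: (@bigcup_measurable _ (g_sigma_algebraType _)) => n _.
  exact: (gB n).1.
have gm B : good B -> gmeas G s (\bigcup_n B n).
  by move=> /good_meas; exact: fibers_algebra_gmeas.
pose c := ereal_sup [set gprob G s (\bigcup_n B n) | B in good].
have good0 : good (fun=> set0).
  move=> n; split; first exact: (@measurable0 _ (g_sigma_algebraType _)).
  by apply: perfect_null; [exact: gmeas0|exact: measure0].
have c_ub B : good B -> (gprob G s (\bigcup_n B n) <= c)%E.
  by move=> gB; apply: ereal_sup_ubound; exists B.
have c_fin : c \is a fin_num.
  rewrite ge0_fin_numE; last by apply: le_trans (c_ub _ good0); exact: measure_ge0.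
  apply: (@le_lt_trans _ _ 1%E); last exact: ltry.
  apply: ge_ereal_sup => _ [B gB <-]; apply: probability_le1.
  exact: gmeas_measurable (gm _ gB).
have /choice[B BP] n : exists B, good B /\
    (c - (n.+1%:R^-1)%:E < gprob G s (\bigcup_n B n))%E.
  have n0 : (0 < n.+1%:R^-1 :> R) by rewrite invr_gt0.
  by have [_ [B gB <-] ltB] := ub_ereal_sup_adherent n0 c_fin; exists B.
(* Coding pairs arranges all [B i j] in one sequence; a number coding no pair gives the empty set,
   which is perfect. *)
pose C k := if unpickle k is Some (i, j) then B i j else set0.
have gC : good C.
  move=> k; rewrite /C; case: (unpickle k) => [[i j]|]; first exact: (BP i).1.
  exact: good0 0%N.
have cC : (c <= gprob G s (\bigcup_n C n))%E.
  apply/lee_addgt0Pr => e e0.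
  have [n ne] : exists n, n.+1%:R^-1 < e.
    by have [n] := ltr_add_invr e0; rewrite add0r; exists n.
  have [gB /ltW cB] := BP n.
  rewrite -leeBlDr//; apply: le_trans (le_trans _ cB) _.
    by rewrite leeB// lee_fin ltW.
  apply: gprob_le; [exact: gm|exact: gm|].
  by move=> x [j _ Bx]; exists (pickle (n, j)) => //; rewrite /C pickleK.
exists C; split=> //; apply: contrapT => /(mu_stable_perfect_subset Qd)[].
  exact: (@measurableC _ (g_sigma_algebraType _)) (good_meas _ gC).
move=> P [fP PC pP P0].
(* Prepending [P], disjoint from the union, adds its measure to one that is already at least [c]; as
   [c] is finite, [P] must be null. *)
pose D n := if n is k.+1 then C k else P.
have gD : good D by case.
have DE : \bigcup_n D n = P `|` \bigcup_n C n.
  apply/seteqP; split=> x [].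
  - by case=> [|n] _ Dx; [left|right; exists n].
  - by exists 0%N.
  - by move=> [n _ Cx]; exists n.+1.
have := c_ub D gD; rewrite DE.
have mP := fibers_algebra_gmeas fP.
have -> : gprob G s (P `|` \bigcup_n C n) =
    (gprob G s P + gprob G s (\bigcup_n C n))%E.
  apply: measureU; [exact: gmeas_measurable|exact: gmeas_measurable (gm _ gC)|].
  by apply/seteqP; split=> x // [/PC].
move=> le_c; apply: P0; apply/eqP; rewrite eq_le measure_ge0 andbT.
by rewrite -(subee c_fin) leeBrDr//; apply: le_trans le_c; exact: leeD2l.
Qed.

(** The null remainder of the exhaustion is perfect and joins the sequence as its first set. Making
    the sets disjoint keeps them perfect, as perfection passes to measurable subsets. *)
Lemma perfect_partition d : mu_stable G Q d ->
  exists A : nat -> set (points V s), [/\ \bigcup_n A n = setT,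
    trivIset setT A, forall n, fibers_algebra (A n) & forall n, perfect (A n)].
Proof.
move=> /perfect_exhaustion[B [Bfp B0]].
pose C n := if n is k.+1 then B k else ~` \bigcup_n B n.
have fC n : fibers_algebra (C n).
  case: n => [|n]; last exact: (Bfp n).1.
  apply: (@measurableC _ (g_sigma_algebraType _)).
  apply: (@bigcup_measurable _ (g_sigma_algebraType _)) => n _; exact: (Bfp n).1.
have pC n : perfect (C n).
  case: n => [|n]; last exact: (Bfp n).2.
  by apply: perfect_null => //; exact: fibers_algebra_gmeas (fC 0%N).
have fD n : fibers_algebra (seqDU C n).
  exact: (@seqDU_measurable _ (g_sigma_algebraType (range (fiber Q)))).
exists (seqDU C); split=> //.
- rewrite -seqDU_bigcup_eq; apply/seteqP; split=> // x _.
  have [[n _ Bx]|nBx] := pselect ((\bigcup_n B n) x); first by exists n.+1.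
  by exists 0%N.
- move=> n; apply: perfect_sub (pC n); try exact: fibers_algebra_gmeas.
  exact: subDsetl.
Qed.

End StableRelation.

(** * Intervals of positions in a word *)

Section Blocks.
Set Implicit Arguments.
Unset Strict Implicit.

(** As in [iota a b], the parameter [b] is a length, not the right end. *)
Definition interval_set (n a b : nat) : {set 'I_n} :=
  [set i : 'I_n | a <= i < a + b]%SET.

Lemma positions_filter n (I : {set 'I_n}) (p : pred nat) :
  (forall i : 'I_n, (i \in I) = p i) -> positions I = [seq i <- iota 0 n | p i].
Proof.
move=> Ip; rewrite /positions -val_enum_ord filter_map; congr map.
by rewrite enumT [in LHS]/enum_mem; apply: eq_filter => i; rewrite /= -Ip.
Qed.

Lemma filter_all_true (T : eqType) (p : pred T) (s : seq T) :
  {in s, forall x, p x} -> seq.filter p s = s.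
Proof. by move=> ps; apply/all_filterP/allP. Qed.

Lemma filter_all_false (T : eqType) (p : pred T) (s : seq T) :
  {in s, forall x, ~~ p x} -> seq.filter p s = [::].
Proof.
by move=> ps; apply/eqP; rewrite -[_ == _]negbK -has_filter; apply/hasPn.
Qed.

Lemma positions_interval a b c :
  positions (interval_set (a + (b + c)) a b) = iota a b /\
  positions (~: interval_set (a + (b + c)) a b) = iota 0 a ++ iota (a + b) c.
Proof.
rewrite (@positions_filter _ _ (fun i => a <= i < a + b)); last first.
  by move=> i; rewrite inE.
rewrite (@positions_filter _ _ (fun i => ~~ (a <= i < a + b))); last first.
  by move=> i; rewrite !inE.
have before : {in iota 0 a, forall i, ~~ (a <= i < a + b)}.
  by move=> i; rewrite mem_iota add0n /= negb_and -ltnNge => ->.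
have inside : {in iota a b, forall i, a <= i < a + b}.
  by move=> i; rewrite mem_iota.
have after : {in iota (a + b) c, forall i, ~~ (a <= i < a + b)}.
  by move=> i; rewrite mem_iota negb_and -[~~ (i < _)]leqNgt => /andP[-> _]; rewrite orbT.
rewrite !iotaD add0n !filter_cat; split.
  rewrite [seq.filter _ (iota 0 a)]filter_all_false//.
  rewrite [seq.filter _ (iota a b)]filter_all_true//.
  by rewrite [seq.filter _ _]filter_all_false ?cats0.
rewrite [seq.filter _ (iota 0 a)]filter_all_true//.
rewrite [seq.filter _ (iota a b)]filter_all_false; last first.
  by move=> i /inside ->.
by rewrite [seq.filter _ _]filter_all_true.
Qed.

Lemma select_interval (T : Type) (z1 z2 z3 : seq T) n a b :
  size z1 = a -> size z2 = b -> n = size (z1 ++ z2 ++ z3) ->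
  select (positions (interval_set n a b)) (z1 ++ z2 ++ z3) = z2 /\
  select (positions (~: interval_set n a b)) (z1 ++ z2 ++ z3) = z1 ++ z3.
Proof.
move=> <- <- ->; rewrite !size_cat.
have [-> ->] := positions_interval (size z1) (size z2) (size z3).
rewrite select_cat !select_iota drop0 drop_size_cat// !take_size_cat//.
by rewrite catA drop_size_cat ?size_cat// take_size.
Qed.

End Blocks.

(** * Fibers of [E] over a single block *)

Section SplitFibers.
Set Implicit Arguments.
Unset Strict Implicit.
Local Open Scope classical_set_scope.
Import Order.TTheory GRing.Theory Num.Theory.
Context {R : realType} {m : nat} {V : 'I_m -> pointedType}.
Variable G : gradedProbSpace R V.
Arguments split_at {m V k X} l E.
Context {k : nat} {X : 'I_k -> gsort m}.
Variable E : set (points V (sprod (enum 'I_k) X)).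
Hypothesis E_meas : gmeas G _ E.
Hypothesis E_fibers : measurable_fibers G E.
Variable l : 'I_k.

Let rest := [seq i <- enum 'I_k | i != l].

Lemma enum_split : exists r1 r2 : seq 'I_k,
  enum 'I_k = r1 ++ l :: r2 /\ rest = r1 ++ r2.
Proof.
have := enum_uniq 'I_k; rewrite /rest.
case/splitPr: (mem_enum 'I_k l) => r1 r2.
rewrite cat_uniq /= negb_or => /and3P[_ /andP[lr1 _] /andP[lr2 _]].
exists r1, r2; split=> //; rewrite filter_cat /= eqxx /=.
by rewrite !filter_all_true// => i ir; apply: contraTneq ir => ->.
Qed.

Lemma event_enum :
  measurable_on G (enum 'I_k) [set x | E (ptuple (enum 'I_k) x)].
Proof.
have [|mE _] := event_of_set (Q := [set x | E (ptuple (enum 'I_k) x)])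
  (enum_uniq 'I_k) (erefl (sprod (enum 'I_k) X)) _ E_meas; last exact: mE.
move=> a x aE; suff -> : a = ptuple (enum 'I_k) x by [].
exact: val_inj.
Qed.

Lemma split_at_event :
  split_at l E = event (l :: rest) [set x | E (ptuple (enum 'I_k) x)].
Proof.
have [lE _] := event_enum.
rewrite eventE /=; last 2 first.
- by rewrite filter_uniq ?enum_uniq// mem_filter eqxx.
- apply: local_sub lE => i _; rewrite inE mem_filter mem_enum andbT.
  by case: eqVneq.
by apply/seteqP; split=> _ [x Ex <-]; exists x => //; exact: val_inj.
Qed.

Lemma split_at_measurable : gmeas G _ (split_at l E).
Proof.
rewrite split_at_event.
have [||[_ +] _] := event_widen (r' := l :: rest) (enum_uniq 'I_k) _ _ event_enum.
- by rewrite /= filter_uniq ?enum_uniq// mem_filter eqxx.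
- by move=> i _; rewrite inE mem_filter mem_enum andbT; case: eqVneq.
exact.
Qed.

(** Take for [I] the positions of block [l]. Since [subsort I] is only provably equal to [X l],
    points are matched by their underlying sequences. *)
Lemma split_at_fiber (y : points V (sprod rest X)) :
  exists (I : {set 'I_(size (sprod (enum 'I_k) X))})
    (b : points V (subsort (~: I))), subsort I = X l /\
    forall (x : points V (X l)) (u : points V (subsort I)), val x = val u ->
      fiber (split_at l E) y x <-> coord_fiber E b u.
Proof.
have [r1 [r2 [eE rE]]] := enum_split.
pose W1 := sprod r1 X; pose W2 := sprod r2 X.
have catE (U : Type) (f : 'I_k -> seq U) :
    flatten [seq f i | i <- enum 'I_k] =
    flatten [seq f i | i <- r1] ++ f l ++ flatten [seq f i | i <- r2].
  by rewrite eE map_cat flatten_cat.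
have restE (U : Type) (f : 'I_k -> seq U) :
    flatten [seq f i | i <- rest] =
    flatten [seq f i | i <- r1] ++ flatten [seq f i | i <- r2].
  by rewrite rE map_cat flatten_cat.
have WE : sprod (enum 'I_k) X = W1 ++ X l ++ W2 by exact: catE.
pose I := interval_set (size (sprod (enum 'I_k) X)) (size W1) (size (X l)).
(* The type [U] is arbitrary because this is applied both to sorts and to points. *)
have selE (U : Type) (f : 'I_k -> seq U) : (forall i, size (f i) = size (X i)) ->
    select (positions I) (flatten [seq f i | i <- enum 'I_k]) = f l /\
    select (positions (~: I)) (flatten [seq f i | i <- enum 'I_k]) =
      flatten [seq f i | i <- rest].
  move=> fX; rewrite catE restE; apply: select_interval => //.
    rewrite !size_flatten /shape -!map_comp; congr sumn.
    exact: eq_map.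
  rewrite -catE !size_flatten /shape -!map_comp; congr sumn.
  by apply: eq_map => i /=.
have [IE nIE] := selE _ X (fun=> erefl).
have yb : map tag (val y) = subsort (~: I) by rewrite (eqP (valP y)) /subsort nIE.
exists I, (mkpoints yb); split; first exact: IE.
move=> x u xu; have sz (f : forall i, points V (X i)) i :
  size (val (f i)) = size (X i) by rewrite size_pval.
split=> [[f Ef /(congr1 val)/eqP]|[w [Ew wb] wu]].
  rewrite /= eqseq_cat ?size_pval// => /andP[/eqP fx /eqP fy].
  have [sI snI] := selE _ _ (sz f).
  exists (ptuple (enum 'I_k) f); first split=> //; apply: val_inj => /=.
    by rewrite snI.
  by rewrite sI -xu.
have wE := ptuple_unptuple w (enum_uniq 'I_k).
pose f : forall i, points V (X i) := unptuple (enum 'I_k) (val w).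
exists f; first by rewrite /= wE.
have [sI snI] := selE _ _ (sz f).
apply: val_inj => /=; rewrite -sI -snI.
rewrite -[flatten _]/(val (ptuple (enum 'I_k) f)) wE xu -wu.
by have /(congr1 val) /= -> := wb.
Qed.

(** Fubini would give this only for almost every [y]; for all [y] it rests on the measurability of
    the coordinate fibers of [E]. *)
Lemma split_at_fiber_meas (y : points V (sprod rest X)) :
  gmeas G (X l) (fiber (split_at l E) y).
Proof.
have [I [b [sI yI]]] := split_at_fiber y.
pose P := [set val u | u in coord_fiber E b].
have mP : gmeas G (subsort I) (lift (subsort I) P).
  by rewrite -lift_val; apply: E_fibers; exists b; left.
have -> : fiber (split_at l E) y = lift (X l) P.
  apply/seteqP; split=> x.
    have xI : map tag (val x) = subsort I by rewrite (eqP (valP x)).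
    by move=> /(yI _ (mkpoints xI) erefl) cx; exists (mkpoints xI).
  by move=> [u cu ux]; apply/(yI _ u).
by move: (P) mP; rewrite sI.
Qed.

Lemma val_ecast s s' (e : s = s') (x : points V s) :
  val (ecast z (points V z) e x) = val x.
Proof. by case: s' / e. Qed.

Lemma positions_setT n : positions [set: 'I_n]%SET = iota 0 n.
Proof.
by rewrite (@positions_filter _ _ predT) ?filter_predT// => i; rewrite inE.
Qed.

(** A fiber is an intersection with a single term, which uses all positions of [X l]. *)
Lemma split_at_fiber_definable (y : points V (sprod rest X)) :
  fiber_sigma_algebra E (X l) (fiber (split_at l E) y).
Proof.
have [I [b [sI yI]]] := split_at_fiber y.
apply: sub_sigma_algebra; exists 1%N => //=.
have e : subsort [set: 'I_(size (X l))]%SET = subsort I.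
  by rewrite sI /subsort positions_setT select_iota drop0 take_size.
exists (fun=> [set: _]%SET), (fun=> I), (fun=> e), (fun=> coord_fiber E b).
split; first by move=> _; exists b; left.
have xE (x : points V (X l)) : val x = val (ecast z (points V z) e
    (prestrict [set: 'I_(size (X l))]%SET x)).
  rewrite val_ecast /= positions_setT select_iota drop0 take_oversize//.
  by rewrite size_pval.
apply/seteqP; split=> x.
  by move=> /(yI _ _ (xE x)) cx _; exact: cx.
by move=> /(_ ord0) cx; apply/(yI _ _ (xE x)).

Qed.

Lemma fibers_algebra_definable :
  fibers_algebra (split_at l E) `<=` fiber_sigma_algebra E (X l).
Proof.
apply: smallest_sub; first exact: smallest_sigma_algebra.
by move=> _ [y _ <-]; exact: split_at_fiber_definable.
Qed.

End SplitFibers.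

(** * Two independent copies and boxes with perfect sides *)

Section Doubling.
Set Implicit Arguments.
Unset Strict Implicit.
Local Open Scope classical_set_scope.
Import Order.TTheory GRing.Theory Num.Theory.
Context {R : realType} {m : nat} {V : 'I_m -> pointedType}.
Variable G : gradedProbSpace R V.

Lemma null_on_exists (I J : eqType) (X : I -> gsort m) (r : seq I) (l : seq J)
    (Q : J -> set (forall i, points V (X i))) :
  (forall j, j \in l ->
    measurable_on G r (Q j) /\ gprob G _ (event r (Q j)) = 0%E) ->
  measurable_on G r [set x | exists2 j, j \in l & Q j x] /\
  gprob G _ (event r [set x | exists2 j, j \in l & Q j x]) = 0%E.
Proof.
have mE (l' : seq J) : (forall j, j \in l' -> measurable_on G r (Q j)) ->
    measurable_on G r [set x | exists2 j, j \in l' & Q j x].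
  move=> mQ; rewrite [X in measurable_on _ _ X](_ : _ =
      ~` [set x | forall j, j \in l' -> (~` Q j) x]).
    apply: measurable_onC.
    apply: (measurable_on_all (Q := fun j => ~` Q j)) => j /mQ mj.
    exact: measurable_onC.
  apply/seteqP; split=> x /=; first by move=> [j jl Qx] /(_ j jl).
  by move=> /existsNP[j /not_implyP[jl /contrapT Qx]]; exists j.
move=> mQ; split; first by apply: mE => j /mQ[].
elim: l mQ => [_|j l IH mQ].
  rewrite (_ : event _ _ = set0) ?measure0//.
  by apply/seteqP; split=> // z [].
rewrite (_ : [set x | _] = Q j `|` [set x | exists2 j, j \in l & Q j x]).
  apply: gprob_nullU.
  - by have [[]] := mQ j (mem_head _ _).
  - by apply: (mE _ _).2 => j' j'l; apply: (mQ _ _).1; rewrite inE j'l orbT.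
  - by have [] := mQ j (mem_head _ _).
  - by apply: IH => j' j'l; apply: mQ; rewrite inE j'l orbT.
apply/seteqP; split=> x /=.
  by move=> [j']; rewrite inE => /predU1P[->|j'l]; [left|right; exists j'].
move=> [Qx|[j' j'l Qx]]; first by exists j; rewrite ?mem_head.
by exists j'; rewrite ?inE ?j'l ?orbT.
Qed.

Context {k : nat} {X : 'I_k -> gsort m}.

(* Two independent copies of each block. *)
Definition double_block (j : 'I_k * bool) : gsort m := X j.1.

Definition pick_copies (h : 'I_k -> bool)
    (x : forall j, points V (double_block j)) : forall i, points V (X i) :=
  fun i => x (i, h i).

(** Both copies of a block have the same sort, so every choice [h] gives the original
    distribution. *)
Lemma event_pick_copies (h : 'I_k -> bool) r F : uniq r -> measurable_on G r F ->
  measurable_on G [seq (i, h i) | i <- r] (F \o pick_copies h) /\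
  gprob G _ (event [seq (i, h i) | i <- r] (F \o pick_copies h)) =
  gprob G _ (event r F).
Proof.
move=> ur [lF mF]; apply: event_of_set mF.
- by rewrite map_inj_uniq// => i j [].
- by rewrite /sprod -map_comp.
move=> a x aE; rewrite -[(F \o _) x]/(F (pick_copies h x)) -(event_ptuple _ lF).
suff -> : a = ptuple r (pick_copies h x) by exact: iff_refl.
by apply: val_inj; rewrite aE /= -map_comp.
Qed.

Lemma event_coord j (A : set (points V (double_block j))) :
  gmeas G _ A ->
  measurable_on G [:: j] [set x | A (x j)] /\
  gprob G _ (event [:: j] [set x | A (x j)]) = gprob G _ A.
Proof.
apply: event_of_set => //; first by rewrite /sprod /= cats0.
by move=> a x; rewrite /= cats0 => /val_inj ->; exact: iff_refl.
Qed.

Arguments split_at {m V k X} l E.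
Variable E : set (points V (sprod (enum 'I_k) X)).
Hypothesis E_meas : gmeas G _ E.
Hypothesis E_fibers : measurable_fibers G E.
Variable A : forall t, set (points V (X t)).
Arguments A : clear implicits.
Hypothesis A_meas : forall t, gmeas G (X t) (A t).
Hypothesis A_perfect : forall t, perfect G (split_at t E) (A t).

Let QE : set (forall i, points V (X i)) := [set x | E (ptuple (enum 'I_k) x)].
Let QA : set (forall i, points V (X i)) := [set x | forall t, A t (x t)].

(** This interpolates from the first copy, at [n = 0], to the second, at [n = k], one block at a
    time. *)
Definition hybrid (n : nat) (i : 'I_k) : bool := i < n.

(* The first t blocks of x come from the second copy; replacing the block t as
   well removes the point from E. *)
Definition flips (t : 'I_k) : set (forall j, points V (double_block j)) :=
  [set x : forall j, points V (double_block j) |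
    [/\ A t (x (t, false)), A t (x (t, true)),
    QE (pick_copies (hybrid t) x) & ~ QE (pick_copies (hybrid t.+1) x)]].

Let rest (t : 'I_k) : seq 'I_k := [seq i <- enum 'I_k | i != t].

Lemma mem_rest t i : (i \in rest t) = (i != t).
Proof. by rewrite mem_filter mem_enum andbT. Qed.

Lemma split_at_ptuple t x :
  split_at t E (pcat (x t) (ptuple (rest t) x)) <-> QE x.
Proof.
rewrite (split_at_event E_meas t); have [lE _] := event_enum E_meas.
suff l' : local (t :: rest t) QE.
  rewrite -[pcat _ _]/(pcat (x t) (ptuple (rest t) x)) -(event_ptuple x l').
  suff -> : pcat (x t) (ptuple (rest t) x) = ptuple (t :: rest t) x.
    exact: iff_refl.
  exact: val_inj.
apply: local_sub lE => i _; rewrite inE mem_rest; by case: eqVneq.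
Qed.

(** A flip at [t] involves both copies of block [t] and one copy of every other block. Fubini fixes
    the latter, listed in [others], and measures the former. *)
Let base (t : 'I_k) : seq ('I_k * bool) := [:: (t, false)] ++ [:: (t, true)].
Let others (t : 'I_k) : seq ('I_k * bool) :=
  [seq (i, hybrid t i) | i <- rest t].

Lemma base_others_uniq t : uniq (base t ++ others t).
Proof.
have ur : uniq (rest t) by rewrite filter_uniq ?enum_uniq.
rewrite cat_uniq map_inj_uniq ?ur ?andbT; last by move=> i j [].
apply/andP; split; first by rewrite /= inE xpair_eqE andbF.
apply/hasPn => _ /mapP[i + ->].
by rewrite mem_rest /= !inE !xpair_eqE => /negPf ->.
Qed.

Lemma flips_measurable t : measurable_on G (base t ++ others t) (flips t).
Proof.
(* The two hybrids differ only at block [t]; elsewhere both use the copies in [others t]. *)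
have hyb n : n = t :> nat \/ n = t.+1 ->
    {subset [seq (i, hybrid n i) | i <- enum 'I_k] <= base t ++ others t}.
  move=> nt _ /mapP[i _ ->]; rewrite mem_cat; have [->|it] := eqVneq i t.
    by rewrite !inE !xpair_eqE eqxx; case: (hybrid _ _).
  apply/orP; right; apply/mapP; exists i; first by rewrite mem_rest.
  congr pair; case: nt => ->//; rewrite /hybrid ltnS leq_eqVlt.
  by rewrite -[(i : nat) == t]/(i == t) (negPf it).
have mE n : n = t :> nat \/ n = t.+1 ->
    measurable_on G (base t ++ others t) (QE \o pick_copies (hybrid n)).
  move=> nt; have [mn _] := event_pick_copies (hybrid n) (enum_uniq _)
    (event_enum E_meas).
  apply: (event_widen _ (base_others_uniq t) (hyb n nt) mn).1.
  by rewrite map_inj_uniq ?enum_uniq// => i j [].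
have mA c : measurable_on G (base t ++ others t) 
      [set x : forall j, points V (double_block j) | A t (x (t, c))].
  have [mc _] := @event_coord (t, c) _ (A_meas t).
  apply: (event_widen _ (base_others_uniq t) _ mc).1 => // j.
  by rewrite !inE => /eqP ->; rewrite !xpair_eqE eqxx; case: (c).
have := measurable_onI (measurable_onI (mA false) (mA true))
  (measurable_onI (mE _ (or_introl erefl)) (measurable_onC (mE _ (or_intror erefl)))).
rewrite [X in measurable_on _ _ X -> _](_ : _ = flips t)//.
by apply/seteqP; split=> x; [move=> [[? ?] [? ?]]|move=> [? ? ? ?]].
Qed.

(** With the other blocks fixed outside a null set, a flip puts the first copy of block [t] inside
    the fiber and the second outside. These events are independent, and perfection of [A t] makes
    one of them null. *)
Lemma flips_null t : gprob G _ (event (base t ++ others t) (flips t)) = 0%E.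
Proof.
have [N [mN N0 AN]] := A_perfect t.
rewrite event_null_fiber; [|exact: base_others_uniq|exact: flips_measurable].
exists [set val y | y in N].
have -> : sprod (others t) double_block = sprod (rest t) X.
  by rewrite /sprod -map_comp.
rewrite -lift_val; split=> // y Ny.
pose y0 : points V (sprod (rest t) X) :=
  ptuple (rest t) (pick_copies (hybrid t) y).
have Ny0 : ~ N y0.
  by move=> Ny0; apply: Ny; exists y0; rewrite //= -map_comp.
have mf := split_at_fiber_meas E_fibers y0.
rewrite [X in event _ X](_ : _ =
  [set x : forall j, points V (double_block j) |
    (A t `&` fiber (split_at t E) y0) (x (t, false))] `&`
  [set x : forall j, points V (double_block j) |
    (A t `\` fiber (split_at t E) y0) (x (t, true))]); last first.
  pose z x : forall j, points V (double_block j) :=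
    fun j => if j \in base t then x j else y j.
  (* Off block [t] both hybrids read the fixed values, so they refer to the same fiber over [y0]; at
     block [t] they read the copy [c]. *)
  have fiber_z n c x : (forall i, hybrid n i = if i == t then c else hybrid t i) ->
      QE (pick_copies (hybrid n) (z x)) <-> fiber (split_at t E) y0 (x (t, c)).
    move=> nc; rewrite -(split_at_ptuple t) /fiber /mkset.
    suff [-> ->] : pick_copies (hybrid n) (z x) t = x (t, c) /\
        ptuple (rest t) (pick_copies (hybrid n) (z x)) = y0.
      exact: iff_refl.
    split.
      rewrite /pick_copies nc eqxx /z ifT//.
      by rewrite !inE !xpair_eqE eqxx; case: c {nc}.
    apply: val_inj => /=; congr flatten; apply/eq_in_map => i.
    rewrite mem_rest => it; rewrite /pick_copies nc (negPf it) /z ifF//.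
    by rewrite !inE !xpair_eqE (negPf it).
  have f0 x : QE (pick_copies (hybrid t) (z x)) <->
      fiber (split_at t E) y0 (x (t, false)).
    by apply: fiber_z => i; case: eqVneq => // ->; rewrite /hybrid ltnn.
  have f1 x : QE (pick_copies (hybrid t.+1) (z x)) <->
      fiber (split_at t E) y0 (x (t, true)).
    apply: fiber_z => i; rewrite /hybrid ltnS leq_eqVlt -val_eqE.
    by case: eqP.
  have zE c x : z x (t, c) = x (t, c).
    by rewrite /z ifT// !inE !xpair_eqE eqxx; case: c.
  apply/seteqP; split=> x.
    rewrite -[X in X -> _]/(flips t (z x)) => -[].
    by rewrite !zE => A0 A1 /f0 E0 nE1; do 2 split=> //; move/f1.
  move=> [[A0 /f0 E0] [A1 nE1]]; suff : flips t (z x) by [].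
  by split; rewrite ?zE// => /f1.
have [m0 p0] := event_coord (j := (t, false)) (gmeasI (A_meas t) mf).
have [m1 p1] := event_coord (j := (t, true)) (gmeasD (A_meas t) mf).
rewrite event_cat ?p0 ?p1//; last by rewrite /= inE xpair_eqE andbF.
by have [->|->] := AN _ Ny0; rewrite ?mul0e ?mule0.
Qed.

Lemma box_measurable_on : measurable_on G (enum 'I_k) QA.
Proof.
rewrite [QA](_ : _ = [set x | forall t, t \in enum 'I_k -> A t (x t)]); last first.
  by apply/seteqP; split=> x Ax t => [_|]; apply: Ax; rewrite mem_enum.
apply: measurable_on_all => t _.
have [|||mt _] := event_of_set (r := [:: t]) (X := X)
  (Q := [set x | A t (x t)]) _ _ _ (A_meas t).
- by [].
- by rewrite /sprod /= cats0.
- by move=> a x; rewrite /= cats0 => /val_inj ->; exact: iff_refl.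
apply: (event_widen _ (enum_uniq _) _ mt).1 => // i _.
by rewrite mem_enum.
Qed.

Lemma box_event : box A = event (enum 'I_k) QA.
Proof. by rewrite eventE ?enum_uniq//; exact: box_measurable_on.1. Qed.

Lemma set_event : E = event (enum 'I_k) QE.
Proof.
have zE (z : points V (sprod (enum 'I_k) X)) := ptuple_unptuple z (enum_uniq 'I_k).
by apply/seteqP; split=> z Ez; [rewrite -(zE z) in Ez|rewrite -(zE z)].
Qed.

(** The product of the two measures is the measure of an event on independent copies that forces a
    flip at some block. *)
Lemma box_dichotomy :
  gprob G _ (E `&` box A) = 0%E \/ gprob G _ (box A `\` E) = 0%E.
Proof.
have mE := event_enum E_meas; have mA := box_measurable_on.
have mEA := measurable_onI mE mA.
have mAE := measurable_onI mA (measurable_onC mE).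
rewrite box_event [in X in X \/ _]set_event [in X in _ \/ X]set_event.
have [m0 p0] := event_pick_copies (fun=> false) (enum_uniq _) mEA.
have [m1 p1] := event_pick_copies (fun=> true) (enum_uniq _) mAE.
set r0 := [seq (i, _) | i <- _] in m0 p0.
set r1 := [seq (i, _) | i <- _] in m1 p1.
have uc (c : bool) : uniq [seq (i, c) | i <- enum 'I_k].
  by rewrite map_inj_uniq ?enum_uniq// => i j [].
have u01 : uniq (r0 ++ r1).
  rewrite cat_uniq !uc andbT.
  by apply/hasPn => _ /mapP[i _ ->]; apply/mapP => -[].
have all01 j : j \in r0 ++ r1.
  by case: j => i []; rewrite mem_cat; apply/orP; [right|left];
    apply/mapP; exists i; rewrite ?mem_enum.
have := event_cat u01 m0 m1; rewrite p0 p1.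
suff -> : gprob G _ (event (r0 ++ r1) (((QE `&` QA) \o pick_copies (fun=> false)) `&`
    ((QA `&` ~` QE) \o pick_copies (fun=> true)))) = 0%E.
  by move=> /esym/eqP; rewrite mule_eq0 => /orP[] /eqP; [left|right].
have [mF F0] : measurable_on G (r0 ++ r1)
      [set x | exists2 t, t \in enum 'I_k & flips t x] /\
    gprob G _ (event (r0 ++ r1)
      [set x | exists2 t, t \in enum 'I_k & flips t x]) = 0%E.
  apply: null_on_exists => t _.
  have [|mt ->] := event_widen (base_others_uniq t) u01 _ (flips_measurable t).
    by move=> j _; exact: all01.
  by split=> //; exact: flips_null.
apply: gprob_null_sub F0; [|exact: mF.2|].
  have [||w0 _] := event_widen _ u01 _ m0.
  - by move: u01; rewrite cat_uniq => /andP[].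
  - by move=> j _; exact: all01.
  have [||w1 _] := event_widen _ u01 _ m1.
  - by move: u01; rewrite cat_uniq => /and3P[].
  - by move=> j _; exact: all01.
  exact: (measurable_onI w0 w1).2.
move=> z.
pose x : forall j, points V (double_block j) := unptuple (r0 ++ r1) (val z).
move=> -[[Ex Ax0] [Ax1 nEx]].
apply: contrapT => noflip; apply: nEx.
(* Without a flip, membership in [E] passes from each hybrid to the next, and finally to the second
   copy. *)
have hyb n : n <= k -> QE (pick_copies (hybrid n) x).
  elim: n => [_|n IH nk]; first exact: Ex.
  apply: contrapT => nEx; apply: noflip; exists (Ordinal nk); first by rewrite mem_enum.
  by split=> //; exact: IH (ltnW nk).
apply: mE.1 (hyb k (leqnn k)) => i _.
by rewrite /pick_copies /hybrid ltn_ord.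
Qed.

End Doubling.

(** * Partitions of all blocks and densities on their boxes *)

Theorem proposition3p12 (R : realType) (m : nat) (V : 'I_m -> pointedType)
    (G : gradedProbSpace R V) (k : nat) (k_gt0 : (0 < k)%N)
    (X : 'I_k -> gsort m) (E : set (points V (sprod (enum 'I_k) X)))
    (E_meas : gmeas G _ E) (E_fibers : measurable_fibers G E) :
  partition_wise_mu_stable G E -> definable_perfect_stable_regularity G E.
Proof.
move=> [d _ Ed].
have stable_part t := perfect_partition (split_at_measurable E_meas t)
  (split_at_fiber_meas E_fibers (l:=t)) (Ed t).
exists (fun t => sval (cid (stable_part t))); split=> [t|i].
  case: cid => A /= [AT tA fA _]; split=> // i.
  exact: fibers_algebra_definable.
rewrite /=; set A := fun t => _; set B := box A.
have mA t : gmeas G (X t) (A t).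
  rewrite /A; case: cid => A' /= [_ _ fA _].
  exact: (fibers_algebra_gmeas (split_at_fiber_meas E_fibers (l:=t))).
have pA t : perfect G (split_at E) (A t).
  by rewrite /A; case: cid => A' /= [_ _ _].
have mB : gmeas G _ B by rewrite /B (box_event mA); exact: (box_measurable_on mA).2.
move=> PB0; have [E0|E0] := box_dichotomy E_meas E_fibers mA pA.
  by left; rewrite E0 GRing.mul0r.
(* Here the part of the box outside [E] is null, so additivity gives [E] full measure in the box. *)
right; suff -> : gprob G _ (setI E B) = gprob G _ B by rewrite GRing.divff.
have /= := measureDI (gprob G _) (gmeas_measurable mB) (gmeas_measurable E_meas).
by rewrite E0 add0e setIC => ->.
Qed.
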